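(* Let $R=\mathbb{F}_2[x^{\pm1},y^{\pm1}]$ and let $f,g\in R$ be such that $|R/(f,g)|<\infty$. Let $\ell_o$ and $m_o$ be the anyon periods along the $x$ and $y$ directions, i.e. the smallest positive integers such that $x^{\ell_o}-1\in(f,g)$ and $y^{m_o}-1\in(f,g)$, respectively. For positive integers $\ell,m$ let $$k(\ell,m)=\dim_{\mathbb{F}_2}\frac{R}{(f,g,x^{\ell}-1,y^{m}-1)}.$$ Then for all positive integers $\ell,m$, $$k(\ell,m)=k\big(\gcd(\ell,\ell_o),\gcd(m,m_o)\big).$$
   Context: $R=\mathbb{F}_2[x^{\pm1},y^{\pm1}]$ is the Laurent polynomial ring over the field with two elements, and $(h_1,\dots,h_n)$ denotes the ideal of $R$ generated by $h_1,\dots,h_n$. *)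

(* Defs.v *)
From HB Require Import structures.
From mathcomp Require Import all_boot all_order all_algebra.
From mathcomp Require Import finmap boolp classical_sets cardinality.
From mathcomp Require Import monalg.

Set Implicit Arguments.
Unset Strict Implicit.
Unset Printing Implicit Defensive.

Import GRing.Theory.

Local Open Scope ring_scope.

(* [laurent R] is R[x^{+-1}, y^{+-1}]: finitely supported functions from the
   exponents (i, j) in Z^2 to R, with the convolution product. The ring
   structure of [monalg] does not apply, because its [monomType] excludes
   invertible monomials; the product below is the same formula. *)
Definition laurent (R : comNzRingType) : Type := {malg R[(int * int)%type]}.

HB.instance Definition _ (R : comNzRingType) :=
  GRing.Lmodule.copy (laurent R) {malg R[(int * int)%type]}.

Section LaurentRing.
Variable R : comNzRingType.
Implicit Types p q r : laurent R.

Definition monomial (c : R) (u : int * int) : laurent R := << c *g u >>.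

Definition laurent_one : laurent R := monomial 1 0.

Definition laurent_mul p q : laurent R :=
  \sum_(u <- msupp p) \sum_(v <- msupp q) monomial (p@_u * q@_v) (u + v).

Let monomial0 u : monomial 0 u = 0.
Proof. exact: monalgU0. Qed.

Let monomialD u c d : monomial (c + d) u = monomial c u + monomial d u.
Proof. exact: monalgUD. Qed.

Let laurentE p : p = \sum_(u <- msupp p) monomial p@_u u.
Proof. exact: monalgE. Qed.

Let laurent_mulEw (d1 d2 : {fset int * int}) p q :
    (msupp p `<=` d1)%fset -> (msupp q `<=` d2)%fset ->
  laurent_mul p q =
    \sum_(u <- d1) \sum_(v <- d2) monomial (p@_u * q@_v) (u + v).
Proof.
move=> le1 le2; rewrite /laurent_mul (big_fset_incl _ le1) /=.
  apply: eq_bigr => u _; apply: (big_fset_incl _ le2) => v _ /mcoeff_outdom ->.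
  by rewrite mulr0 monomial0.
move=> u _ /mcoeff_outdom ->.
by rewrite big1 // => v _; rewrite mul0r monomial0.
Qed.

Let laurent_mulC : commutative laurent_mul.
Proof.
move=> p q; rewrite /laurent_mul exchange_big /=.
by apply: eq_bigr => u _; apply: eq_bigr => v _; rewrite mulrC addrC.
Qed.

Let laurent_mul0l : left_zero 0 laurent_mul.
Proof. by move=> p; rewrite /laurent_mul msupp0 big_seq_fset0. Qed.

Let laurent_mulDl : left_distributive laurent_mul +%R.
Proof.
move=> p q r.
rewrite (laurent_mulEw (msuppD_le p q) (fsubset_refl (msupp r))).
rewrite (laurent_mulEw (fsubsetUl _ (msupp q)) (fsubset_refl (msupp r))).
rewrite (laurent_mulEw (fsubsetUr (msupp p) _) (fsubset_refl (msupp r))).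
rewrite -big_split /=; apply: eq_bigr => u _.
rewrite -big_split /=; apply: eq_bigr => v _.
by rewrite mcoeffD mulrDl monomialD.
Qed.

Let laurent_mul_suml I (s : seq I) (F : I -> laurent R) q :
  laurent_mul (\sum_(i <- s) F i) q = \sum_(i <- s) laurent_mul (F i) q.
Proof.
exact: (big_morph (laurent_mul^~ q) (fun _ _ => laurent_mulDl _ _ _)
  (laurent_mul0l q)).
Qed.

Let laurent_mul_sumr I (s : seq I) (F : I -> laurent R) q :
  laurent_mul q (\sum_(i <- s) F i) = \sum_(i <- s) laurent_mul q (F i).
Proof.
rewrite laurent_mulC laurent_mul_suml.
by apply: eq_bigr => i _; rewrite laurent_mulC.
Qed.

Let laurent_mulUU c d u v :
  laurent_mul (monomial c u) (monomial d v) = monomial (c * d) (u + v).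
Proof.
by rewrite (laurent_mulEw msuppU_le msuppU_le) !big_seq_fset1 !mcoeffUU.
Qed.

Let laurent_mulA : associative laurent_mul.
Proof.
move=> p q r; rewrite (laurentE p) !laurent_mul_suml; apply: eq_bigr => u _.
rewrite (laurentE q) laurent_mul_suml !laurent_mul_sumr laurent_mul_suml.
apply: eq_bigr => v _; rewrite (laurentE r) !laurent_mul_sumr.
by apply: eq_bigr => w _; rewrite !laurent_mulUU mulrA addrA.
Qed.

Let laurent_mul1l : left_id laurent_one laurent_mul.
Proof.
move=> p; rewrite [in LHS](laurentE p) laurent_mul_sumr [RHS]laurentE.
by apply: eq_bigr => u _; rewrite laurent_mulUU mul1r add0r.
Qed.

Let laurent_one_neq0 : laurent_one != 0.
Proof.
by apply/eqP => /malgP /(_ 0) /eqP; rewrite mcoeffUU mcoeff0 oner_eq0.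
Qed.

HB.instance Definition _ := GRing.Zmodule_isComNzRing.Build (laurent R)
  laurent_mulA laurent_mulC laurent_mul1l laurent_mulDl laurent_one_neq0.

Let laurent_scaleAl (c : R) p q : c *: (p * q) = (c *: p) * q.
Proof.
have scaleE d (t : laurent R) : d *: t = monomial d 0 * t.
  rewrite [in RHS](laurentE t) [RHS]laurent_mul_sumr [LHS]malgZ_def.
  by apply: eq_bigr => u _; rewrite [RHS]laurent_mulUU add0r.
by rewrite !scaleE mulrA.
Qed.

HB.instance Definition _ := GRing.Lmodule_isLalgebra.Build R (laurent R)
  laurent_scaleAl.
HB.instance Definition _ := GRing.Lalgebra_isComAlgebra.Build R (laurent R).

Definition Lx : laurent R := monomial 1 (1, 0).
Definition Ly : laurent R := monomial 1 (0, 1).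

Lemma monomialM c d u v :
  monomial c u * monomial d v = monomial (c * d) (u + v).
Proof. exact: laurent_mulUU. Qed.

Lemma Lx_inv : Lx * monomial 1 (-1, 0) = 1.
Proof. by rewrite monomialM mulr1. Qed.

Lemma Ly_inv : Ly * monomial 1 (0, -1) = 1.
Proof. by rewrite monomialM mulr1. Qed.

End LaurentRing.

Arguments Lx {R}.
Arguments Ly {R}.

Section Ideal.
Variables (F : comNzRingType) (A : comAlgType F).

Definition ideal (s : seq A) : {pred A} :=
  fun h => `[< exists c : 'I_(size s) -> A, h = \sum_i c i * s`_i >].

Lemma idealP s h :
  reflect (exists c : 'I_(size s) -> A, h = \sum_i c i * s`_i) (h \in ideal s).
Proof. exact: asboolP. Qed.

Let ideal_submod_closed s : submod_closed (ideal s).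
Proof.
split=> [|a p q /idealP[c ->] /idealP[d ->]]; apply/idealP.
  by exists (fun=> 0); rewrite big1 // => i _; rewrite mul0r.
exists (fun i => a *: c i + d i); rewrite scaler_sumr -big_split /=.
by apply: eq_bigr => i _; rewrite mulrDl scalerAl.
Qed.

HB.instance Definition _ (s : seq A) :=
  GRing.isSubmodClosed.Build F A (ideal s) (ideal_submod_closed s).

End Ideal.

(* The library gives [{ideal_quot _}] a ring structure only for proper ideals,
   and no F-linear structure. The latter is added here for every ideal,
   including the unit ideal. *)
Section IdealQuotient.
Local Open Scope quotient_scope.
Variables (F : comNzRingType) (A : comAlgType F) (s : seq A).
Local Notation Q := {ideal_quot ideal s}.

Definition quot_scale (a : F) (x : Q) : Q := \pi_Q (a *: repr x).

Let pi_scale a (v : A) : quot_scale a (\pi_Q v) = \pi_Q (a *: v).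
Proof.
apply/eqP; rewrite -Quotient.idealrBE -scalerBr rpredZ //.
by rewrite Quotient.idealrBE reprK.
Qed.

Let quot_scaleA a b x : quot_scale a (quot_scale b x) = quot_scale (a * b) x.
Proof. by rewrite -[x]reprK (pi_scale b) !pi_scale scalerA. Qed.

Let quot_scale1 : left_id 1 quot_scale.
Proof. by move=> x; rewrite -[x]reprK pi_scale scale1r. Qed.

Let quot_scaleDr : right_distributive quot_scale +%R.
Proof.
by move=> a x y; rewrite -[x]reprK -[y]reprK -raddfD !pi_scale scalerDr raddfD.
Qed.

Let quot_scaleDl x : {morph quot_scale^~ x : a b / a + b}.
Proof.
by move=> a b; rewrite -[x]reprK !pi_scale scalerDl raddfD.
Qed.

HB.instance Definition _ := GRing.Zmodule_isLmodule.Build F Q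
  quot_scaleA quot_scale1 quot_scaleDr quot_scaleDl.
End IdealQuotient.

(* The n such that V is linearly isomorphic to F^n; by convention 0 if V is not
   finite-dimensional. *)
Definition dimension (F : fieldType) (V : lmodType F) : nat :=
  xget 0%N [set n | inhabited (Vector.axiom n V)]%classic.

Lemma dimensionE (F : fieldType) (V : lmodType F) n :
  Vector.axiom n V -> dimension V = n.
Proof.
suff le p q : Vector.axiom p V -> Vector.axiom q V -> (p <= q)%N.
  move=> Vn; rewrite /dimension; case: xgetP => [m _ [Vm]|/(_ n) /=].
    by apply/eqP; rewrite eqn_leq (le _ _ Vm Vn) (le _ _ Vn Vm).
  by case; exists.
move=> [f lf [f' fK f'K]] [g lg [g' gK g'K]].
pose Lf := GRing.isLinear.Build F V 'rV_p _ f lf.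
pose Lg := GRing.isLinear.Build F V 'rV_q _ g lg.
pose fL : {linear V -> 'rV_p} := HB.pack f Lf.
pose gL : {linear V -> 'rV_q} := HB.pack g Lg.
have lf' : linear f'.
  move=> a u v; apply: (can_inj fK); rewrite f'K.
  by rewrite -[f]/(fL : V -> _) linearP /= !f'K.
have lh : linear (g \o f') by move=> a u v /=; rewrite lf' lg.
pose Lh := GRing.isLinear.Build F 'rV_p 'rV_q _ (g \o f') lh.
pose h : {linear 'rV_p -> 'rV_q} := HB.pack (g \o f') Lh.
suff /eqP <- : row_free (lin1_mx h) by apply: rank_leq_col.
apply/inj_row_free => u; rewrite mul_rV_lin1 /= => gf'0.
have := congr1 g' gf'0; rewrite gK => f'u.
have g'0 : g' 0 = 0 by rewrite -[0 in LHS](linear0 gL) gK.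
by rewrite -[u]f'K f'u g'0; apply: (linear0 fL).
Qed.

Definition anyon_period (A : comNzRingType) (I : {pred A}) (z : A) (p : nat) :=
  [/\ (0 < p)%N, z ^+ p - 1 \in I
    & forall j : nat, (0 < j)%N -> z ^+ j - 1 \in I -> (p <= j)%N].

Definition k (f g : laurent 'F_2) (l m : nat) : nat :=
  @dimension 'F_2 {ideal_quot ideal [:: f; g; Lx ^+ l - 1; Ly ^+ m - 1]}.

(* Main.v *)
(* The ideals defining the two sides coincide.  Modulo (f, g) we have
   x^lo = 1, so modulo (f, g, x^l - 1, y^m - 1) both x^l and x^lo are 1; by
   Bezout x^gcd(l, lo) = 1 as well, and likewise for y. Conversely x^l - 1 is a
   multiple of x^gcd(l, lo) - 1. *)
Require Import Defs.
From mathcomp Require Import all_boot all_order all_algebra.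
From mathcomp Require Import classical_sets cardinality.

Set Implicit Arguments.
Unset Strict Implicit.
Unset Printing Implicit Defensive.

Import GRing.Theory.

Local Open Scope ring_scope.

Section IdealTheory.
Variables (F : comNzRingType) (A : comAlgType F).
Implicit Types (s t : seq A) (z p : A).

Lemma mem_ideal s p : p \in s -> p \in ideal s.
Proof.
move=> ps; have lt_i : (index p s < size s)%N by rewrite index_mem.
(* The coefficient is 1 at the first occurrence of [p] and 0 elsewhere, so repeated generators are
   counted once. *)
apply/idealP; exists (fun i => (i == Ordinal lt_i)%:R).
rewrite (bigD1 (Ordinal lt_i)) //= eqxx mul1r nth_index // big1 ?addr0 //.
by move=> i /negPf ->; rewrite mul0r.
Qed.

Lemma idealMl s c p : p \in ideal s -> c * p \in ideal s.
Proof.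
move=> /idealP[e ->]; apply/idealP; exists (fun i => c * e i).
by rewrite mulr_sumr; apply: eq_bigr => i _; rewrite mulrA.
Qed.

Lemma sub_ideal s t : {subset s <= ideal t} -> {subset ideal s <= ideal t}.
Proof.
move=> st p /idealP[c ->]; apply: rpred_sum => i _.
by apply: idealMl; apply: st; apply: mem_nth.
Qed.

(** Geometric sum: with w = z^d, w - 1 divides w^q - 1. *)
Lemma ideal_expr_dvdn s z d n :
  (d %| n)%N -> z ^+ d - 1 \in ideal s -> z ^+ n - 1 \in ideal s.
Proof.
move=> /dvdnP[q ->] zd; rewrite mulnC exprM subrX1 mulrC.
exact: idealMl.
Qed.

Lemma ideal_expr_gcdn s z a b : (0 < a)%N ->
  z ^+ a - 1 \in ideal s -> z ^+ b - 1 \in ideal s ->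
  z ^+ gcdn a b - 1 \in ideal s.
Proof.
(* Bezout without subtraction, u a = v b + gcd(a, b), keeps every exponent of z a natural number;
   positivity of [a] guarantees such u and v. *)
move=> a_gt0 za zb; case: (egcdnP b a_gt0) => u v uv _.
have zu : z ^+ (u * a) - 1 \in ideal s.
  by apply: ideal_expr_dvdn za; apply: dvdn_mull.
have zv : z ^+ (v * b) - 1 \in ideal s.
  by apply: ideal_expr_dvdn zb; apply: dvdn_mull.
have -> : z ^+ gcdn a b - 1 =
    (z ^+ (u * a) - 1) - z ^+ gcdn a b * (z ^+ (v * b) - 1).
  by rewrite uv addnC exprD mulrBr mulr1 opprB [RHS]addrC addrA subrK.
by rewrite rpredB // idealMl.
Qed.

Lemma ideal_gcdn (f g x y : A) a b l m : (0 < l)%N -> (0 < m)%N ->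
  x ^+ a - 1 \in ideal [:: f; g] -> y ^+ b - 1 \in ideal [:: f; g] ->
  ideal [:: f; g; x ^+ l - 1; y ^+ m - 1] =i
  ideal [:: f; g; x ^+ gcdn l a - 1; y ^+ gcdn m b - 1].
Proof.
move=> l_gt0 m_gt0 xa yb.
have gens z w : [/\ f \in ideal [:: f; g; z; w], g \in ideal [:: f; g; z; w],
    z \in ideal [:: f; g; z; w] & w \in ideal [:: f; g; z; w]].
  by split; apply: mem_ideal; rewrite !in_cons eqxx ?orbT.
have sub4 z w t : f \in ideal t -> g \in ideal t -> z \in ideal t ->
    w \in ideal t -> {subset ideal [:: f; g; z; w] <= ideal t}.
  move=> ft gt zt wt; apply: sub_ideal => p.
  by rewrite !(in_cons, in_nil) orbF => /or4P[] /eqP ->.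
have fg_sub z w : {subset ideal [:: f; g] <= ideal [:: f; g; z; w]}.
  have [fI gI _ _] := gens z w; apply: sub_ideal => p.
  by rewrite !(in_cons, in_nil) orbF => /orP[] /eqP ->.
have [fI gI xI yI] := gens (x ^+ l - 1) (y ^+ m - 1).
have [fJ gJ xJ yJ] := gens (x ^+ gcdn l a - 1) (y ^+ gcdn m b - 1).
(* The first two goals place x^l - 1 and y^m - 1 in the gcd ideal by divisibility; the last two are
   the converse, by Bezout with the relations inherited from (f, g). *)
move=> p; apply/idP/idP; apply: sub4 => //.
- exact: ideal_expr_dvdn (dvdn_gcdl l a) xJ.
- exact: ideal_expr_dvdn (dvdn_gcdl m b) yJ.
- by apply: ideal_expr_gcdn => //; apply: fg_sub.
- by apply: ideal_expr_gcdn => //; apply: fg_sub.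
Qed.

End IdealTheory.

Section Dimension.
Variable F : fieldType.

Lemma vector_axiom_bij (V W : lmodType F) (phi : V -> W) n :
  linear phi -> bijective phi -> Vector.axiom n W -> Vector.axiom n V.
Proof.
move=> lphi bphi [h lh bh]; exists (h \o phi); last exact: bij_comp.
by move=> a u v /=; rewrite lphi lh.
Qed.

Lemma eq_dimension (V W : lmodType F) (phi : V -> W) (psi : W -> V) :
  linear phi -> cancel phi psi -> cancel psi phi ->
  dimension V = dimension W.
Proof.
(* It suffices that V and W admit the same set of n. If that set is empty, both sides take the
   default 0, so infinite dimension needs no separate case. *)
move=> lphi phiK psiK; rewrite /dimension; congr (xget _ _).
apply/seteqP; split=> n [Hn]; constructor.
  apply: (vector_axiom_bij (phi := psi)) Hn; last by exists phi.
  by move=> a u v; apply: (can_inj phiK); rewrite lphi !psiK.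
by apply: (vector_axiom_bij lphi) Hn; exists psi.
Qed.

Local Open Scope quotient_scope.

(** The ideals agree only pointwise and the quotients are distinct types, so the identity of A has
    to be carried to an explicit linear isomorphism between them. *)
Lemma eq_ideal_dimension (A : comAlgType F) (s t : seq A) :
  ideal s =i ideal t ->
  dimension {ideal_quot ideal s} = dimension {ideal_quot ideal t}.
Proof.
pose Q (s : seq A) := {ideal_quot ideal s}.
pose tr (s t : seq A) (v : Q s) : Q t := \pi_(Q t) (repr v).
(* Independence of the representative: [repr] of the class of p differs from p by an element of the
   common ideal. *)
have tr_pi s' t' : ideal s' =i ideal t' ->
    forall p, tr s' t' (\pi_(Q s') p) = \pi_(Q t') p.
  move=> st p; apply/eqP; rewrite -Quotient.idealrBE -st.
  by rewrite Quotient.idealrBE reprK.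
have scaleE s' (a : F) (p : A) : a *: \pi_(Q s') p = \pi_(Q s') (a *: p).
  apply/eqP; rewrite -Quotient.idealrBE -scalerBr rpredZ //.
  by rewrite Quotient.idealrBE reprK.
move=> st; have ts : ideal t =i ideal s by move=> p; rewrite st.
have [trst trts] := (tr_pi _ _ st, tr_pi _ _ ts).
clearbody tr.
apply: (@eq_dimension _ _ (tr s t) (tr t s)).
- move=> a u v; rewrite -[u]reprK -[v]reprK scaleE -raddfD !trst.
  by rewrite raddfD scaleE.
- by move=> u; rewrite -[u]reprK trst trts.
- by move=> u; rewrite -[u]reprK trts trst.
Qed.

End Dimension.

Theorem theorem4 (f g : laurent 'F_2)
    (fin_fg : finite_set [set: {ideal_quot ideal [:: f; g]}]%classic)
    (lo mo : nat)
    (lo_period : anyon_period (ideal [:: f; g]) Lx lo)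
    (mo_period : anyon_period (ideal [:: f; g]) Ly mo)
    (l m : nat) (l_gt0 : (0 < l)%N) (m_gt0 : (0 < m)%N) :
  k f g l m = k f g (gcdn l lo) (gcdn m mo).
Proof.
case: lo_period mo_period => _ xlo _ [_ ymo _].
exact/eq_ideal_dimension/ideal_gcdn.
Qed.
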